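(* Let $T\in\mathbb{M}_n$ be a Hermitian matrix and let $\lambda_1,\dots,\lambda_n$ be the eigenvalues of $T$. Then the $C^*$-convex hull of $\{T\}$ is $$C^*\text{-}\mathrm{CH}(T)=\left\{\sum_{i=1}^{n}\lambda_iE_i\ ;\ E_i\in\mathbb{M}_n,\ E_i\geq 0\ (i=1,\dots,n),\ \sum_{i=1}^{n}E_i=I\right\}.$$
   Context: $\mathbb{M}_n$ is the algebra of all $n\times n$ complex matrices, with identity $I$; $E\geq 0$ means that $E$ is positive semidefinite. The eigenvalues $\lambda_1,\dots,\lambda_n$ are listed with multiplicity. A set $\mathcal{K}\subseteq\mathbb{M}_n$ is $C^*$-convex if, for every $m\in\mathbb{N}$, all $X_1,\dots,X_m\in\mathcal{K}$ and all $C_1,\dots,C_m\in\mathbb{M}_n$ with $\sum_{i=1}^m C_i^*C_i=I$, one has $\sum_{i=1}^m C_i^*X_iC_i\in\mathcal{K}$. The $C^*$-convex hull $C^*\text{-}\mathrm{CH}(T)$ of $\{T\}$ is the smallest $C^*$-convex subset of $\mathbb{M}_n$ containing $T$; it is known to be equal to the set of all finite sums $\sum_i C_i^*TC_i$ with $C_i\in\mathbb{M}_n$ and $\sum_i C_i^*C_i=I$. *)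

(* Defs.v *)
From mathcomp Require Import all_boot all_order all_algebra.
From mathcomp Require Import sesquilinear spectral.
From mathcomp Require Import complex.
From mathcomp Require Import boolp classical_sets reals.

Set Implicit Arguments.
Unset Strict Implicit.
Unset Printing Implicit Defensive.

Import Order.TTheory GRing.Theory Num.Theory.

Local Open Scope ring_scope.
Local Open Scope complex_scope.
Local Open Scope sesquilinear_scope.
Local Open Scope classical_set_scope.

(* In R[i], 0 <= z says that z is real and nonnegative. *)
Definition psdmx (R : realType) (n : nat) (E : 'M[R[i]]_n) : Prop :=
  E \is hermsymmx /\ forall x : 'cV[R[i]]_n, 0 <= (x ^t* *m E *m x) 0 0.

Definition Cstar_convex (R : realType) (n : nat) (K : set 'M[R[i]]_n) : Prop :=
  forall (m : nat) (X C : 'I_m -> 'M[R[i]]_n),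
    (forall i, K (X i)) ->
    \sum_(i < m) (C i) ^t* *m C i = 1%:M ->
    K (\sum_(i < m) (C i) ^t* *m X i *m C i).

(* [smallest P G] is the intersection of all sets satisfying P that contain G;
   [Cstar_convex] is stable under intersection. *)
Definition Cstar_hull (R : realType) (n : nat) (T : 'M[R[i]]_n) :
    set 'M[R[i]]_n :=
  smallest (@Cstar_convex R n) [set T].

(* Main.v *)
(** Both inclusions rest on the spectral decomposition of T into rank-one
    terms, sum_i lambda_i w_i^* w_i, with (w_i) an orthonormal basis of row
    vectors.  The right-hand side is C*-convex and contains T, by this
    decomposition.  Conversely, split each E_i into rank-one terms f_ik^* f_ik;
    the matrices C_ik = w_i^* f_ik satisfy C_ik^* C_ik = f_ik^* f_ik and
    C_ik^* T C_ik = lambda_i f_ik^* f_ik. *)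
Require Import Defs.
From mathcomp Require Import all_boot all_order all_algebra.
From mathcomp Require Import perm sesquilinear spectral.
From mathcomp Require Import complex.
From mathcomp Require Import boolp classical_sets reals.

Import Order.TTheory GRing.Theory Num.Theory.

Local Open Scope ring_scope.
Local Open Scope complex_scope.
Local Open Scope sesquilinear_scope.
Local Open Scope classical_set_scope.

Lemma trmxC_mul (C : numClosedFieldType) m n p (A : 'M[C]_(m, n))
    (B : 'M[C]_(n, p)) : (A *m B) ^t* = B ^t* *m A ^t*.
Proof. by rewrite trmx_mul map_mxM. Qed.

Lemma trmxCZ (C : numClosedFieldType) m n (a : C) (A : 'M[C]_(m, n)) :
  (a *: A) ^t* = a^* *: A ^t*.
Proof. by rewrite linearZ map_mxZ. Qed.

Lemma trmxC_sum (C : numClosedFieldType) m n (I : finType)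
    (A : I -> 'M[C]_(m, n)) : (\sum_i A i) ^t* = \sum_i (A i) ^t*.
Proof.
by apply/matrixP=> a b; rewrite !mxE !summxE rmorph_sum; apply: eq_bigr => i _;
  rewrite !mxE.
Qed.

Lemma hermsymmxP (C : numClosedFieldType) n (A : 'M[C]_n) :
  reflect (A ^t* = A) (A \is hermsymmx).
Proof.
rewrite is_hermitianmxE expr0 scale1r eq_sym; exact: eqP.
Qed.

Lemma row_mul_trmxC (C : numClosedFieldType) n (P : 'M[C]_n) i j :
  P \is unitarymx -> row i P *m (row j P) ^t* = (i == j)%:R%:M.
Proof.
move=> /unitarymxP/matrixP/(_ i j); rewrite !mxE => PP.
apply/matrixP=> a b; rewrite !ord1 !mxE mulr1n -PP.
by apply: eq_bigr => k _; rewrite !mxE.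
Qed.

(** Orthonormality kills every term except [j = i]. This reads off an eigenvalue from a spectral
    sum, both for [T] and for a positive semidefinite matrix. *)
Lemma orthonormal_compress (C : numClosedFieldType) m n (w : 'I_m -> 'rV[C]_n)
    (a : 'I_m -> C) i :
  (forall j k, w j *m (w k) ^t* = (j == k)%:R%:M) ->
  w i *m (\sum_j a j *: ((w j) ^t* *m w j)) *m (w i) ^t* = (a i)%:M.
Proof.
move=> ww; rewrite mulmx_sumr mulmx_suml (bigD1 i) //= big1 => [|j ji].
  by rewrite addr0 -scalemxAr -scalemxAl mulmxA ww eqxx mul1mx ww eqxx scalemx1.
by rewrite -scalemxAr -scalemxAl mulmxA ww eq_sym (negbTE ji) raddf0 !mul0mx
  scaler0.
Qed.

Lemma trmxC_diag_mul (C : numClosedFieldType) m n (P : 'M[C]_(m, n))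
    (d : 'rV_m) :
  P ^t* *m diag_mx d *m P = \sum_i d 0 i *: ((row i P) ^t* *m row i P).
Proof.
apply/matrixP=> a b; rewrite mul_mx_diag summxE !mxE.
by apply: eq_bigr => i _; rewrite !mxE big_ord1 !mxE mulrAC mulrC.
Qed.

(** The scalar matrix of ['X] commutes with everything, so the characteristic matrix is itself
    conjugated by constant polynomial matrices, whose determinants cancel. *)
Lemma char_poly_conj (F : fieldType) n (P A : 'M[F]_n) :
  P \in unitmx -> char_poly (invmx P *m A *m P) = char_poly A.
Proof.
move=> Pu; rewrite /char_poly.
pose f := map_mx (@polyC F).
have PVP : f _ _ (invmx P) *m f _ _ P = 1%:M.
  by rewrite -map_mxM mulVmx // map_mx1.
suff -> : char_poly_mx (invmx P *m A *m P)
    = f _ _ (invmx P) *m char_poly_mx A *m f _ _ P.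
  by rewrite !det_mulmx mulrAC -det_mulmx PVP det1 mul1r.
rewrite /char_poly_mx mulmxBr mulmxBl -!map_mxM.
by rewrite mul_mx_scalar -scalemxAl PVP scalemx1.
Qed.

(** Unique factorization into linear factors. It is what reconciles the given order of [lambda] with
    that of [spectral_diag T]. *)
Lemma prod_XsubC_perm (F : fieldType) n (a b : 'I_n -> F) :
  \prod_(i < n) ('X - (a i)%:P) = \prod_(i < n) ('X - (b i)%:P) ->
  exists s : {perm 'I_n}, forall i, a i = b (s i).
Proof.
move=> ab; pose ta := [tuple a i | i < n]; pose tb := [tuple b i | i < n].
have tE (f : 'I_n -> F) : \prod_(x <- [tuple f i | i < n]) ('X - x%:P)
    = \prod_(i < n) ('X - (f i)%:P).
  by rewrite big_tuple; apply: eq_bigr => i _; rewrite tnth_mktuple.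
have /tuple_permP [s Es] : perm_eq ta tb.
  by apply: prod_XsubC_eq; rewrite !tE.
exists s => i.
have /(congr1 (fun t => tnth t i)) : ta = [tuple tnth tb (s i) | i < n].
  exact: val_inj.
by rewrite !tnth_mktuple.
Qed.

Lemma hermitian_eigenbasis (C : numClosedFieldType) n (T : 'M[C]_n)
    (lambda : 'I_n -> C) :
  T \is hermsymmx -> char_poly T = \prod_(i < n) ('X - (lambda i)%:P) ->
  exists w : 'I_n -> 'rV[C]_n,
    [/\ forall i j, w i *m (w j) ^t* = (i == j)%:R%:M,
        \sum_i (w i) ^t* *m w i = 1%:M
      & T = \sum_i lambda i *: ((w i) ^t* *m w i)].
Proof.
move=> /hermitian_normalmx /orthomx_spectralP.
set P := spectralmx T; set d := spectral_diag T => TE.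
have Pun : P \is unitarymx := spectral_unitarymx T.
have Pu := unitarymx_unit Pun.
rewrite {1}TE char_poly_conj // char_poly_trig ?diag_mx_is_trig // => lamE.
have [s sE] : exists s : {perm 'I_n}, forall i, lambda i = d 0 (s i).
  apply: prod_XsubC_perm; rewrite -lamE.
  by apply: eq_bigr => i _; rewrite mxE eqxx mulr1n.
(* The rows of the diagonalizing unitary matrix, reordered by [s] so that row [i] belongs to
   [lambda i]. *)
exists (fun i => row (s i) P); split=> [i j||].
- by rewrite row_mul_trmxC // (inj_eq perm_inj).
- rewrite -(mulVmx Pu) invmx_unitary // -[P ^t*]mulmx1 -diag_const_mx.
  rewrite trmxC_diag_mul [RHS](reindex_inj (@perm_inj _ s)).
  by apply: eq_bigr => i _; rewrite mxE scale1r.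
- rewrite {1}TE invmx_unitary // trmxC_diag_mul.
  by rewrite (reindex_inj (@perm_inj _ s)); apply: eq_bigr => i _; rewrite sE.
Qed.

Lemma psdmx_gram (R : realType) n (v : 'rV[R[i]]_n) : psdmx (v ^t* *m v).
Proof.
split=> [|x]; first by apply/hermsymmxP; rewrite trmxC_mul trmxCK.
(* The form at [x] is the squared modulus of the single entry of [v *m x]. *)
rewrite mulmxA -mulmxA -[x ^t* *m _]trmxCK trmxC_mul !trmxCK.
by rewrite mxE big_ord1 !mxE mulrC mul_conjC_ge0.
Qed.

Lemma psdmx_sum (R : realType) n (I : finType) (E : I -> 'M[R[i]]_n) :
  (forall i, psdmx (E i)) -> psdmx (\sum_i E i).
Proof.
move=> E_psd; split=> [|x].
  apply/hermsymmxP; rewrite trmxC_sum; apply: eq_bigr => i _.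
  exact/hermsymmxP/(E_psd i).1.
rewrite mulmx_sumr mulmx_suml summxE sumr_ge0 // => i _.
exact: (E_psd i).2.
Qed.

Lemma psdmx_conj (R : realType) n (E A : 'M[R[i]]_n) :
  psdmx E -> psdmx (A ^t* *m E *m A).
Proof.
move=> [/hermsymmxP Eh E_ge0]; split=> [|x].
  by apply/hermsymmxP; rewrite !trmxC_mul trmxCK Eh mulmxA.
by have := E_ge0 (A *m x); rewrite trmxC_mul !mulmxA.
Qed.

Lemma psdmx_rank1_sum (R : realType) n (E : 'M[R[i]]_n) :
  psdmx E ->
  exists f : 'I_n -> 'rV[R[i]]_n, E = \sum_k (f k) ^t* *m f k.
Proof.
move=> [Eh E_ge0]; have /orthomx_spectralP := hermitian_normalmx Eh.
set P := spectralmx E; set d := spectral_diag E => EE.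
have Pun : P \is unitarymx := spectral_unitarymx E.
rewrite invmx_unitary // in EE.
(* Evaluating the form of [E] at its [k]-th eigenvector returns the eigenvalue. *)
have d_ge0 k : 0 <= d 0 k.
  have := E_ge0 ((row k P) ^t*); rewrite trmxCK {1}EE trmxC_diag_mul.
  rewrite orthonormal_compress ?mxE ?mulr1n // => i j.
  exact: row_mul_trmxC.
(* Each nonnegative eigenvalue is absorbed into its eigenvector through a square root. *)
exists (fun k => sqrtC (d 0 k) *: row k P).
rewrite {1}EE trmxC_diag_mul; apply: eq_bigr => k _.
rewrite trmxCZ -scalemxAl -scalemxAr scalerA; congr (_ *: _).
by rewrite mulrC -normCK ger0_norm ?sqrtC_ge0 // sqrtCK.
Qed.

(** Enumerating [I] reduces this to the ordinal-indexed definition; the main proof needs it for sums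
    over pairs. *)
Lemma Cstar_convex_sum (R : realType) n (K : set 'M[R[i]]_n) (I : finType)
    (X C : I -> 'M[R[i]]_n) :
  Cstar_convex K -> (forall i, K (X i)) ->
  \sum_i (C i) ^t* *m C i = 1%:M -> K (\sum_i (C i) ^t* *m X i *m C i).
Proof.
move=> Kconv KX C1; rewrite (reindex _ (onW_bij _ (@enum_val_bij I))).
apply: Kconv => [i|]; first exact: KX.
by rewrite -C1 [RHS](reindex _ (onW_bij _ (@enum_val_bij I))).
Qed.

Theorem theorem2p8 (R : realType) (n : nat) (T : 'M[R[i]]_n)
    (lambda : 'I_n -> R[i])
    (hT : T \is hermsymmx)
    (* lambda lists the eigenvalues of T with multiplicity *)
    (hlambda : char_poly T = \prod_(i < n) ('X - (lambda i)%:P)) :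
  Cstar_hull T =
    [set X | exists E : 'I_n -> 'M[R[i]]_n,
       [/\ (forall i, psdmx (E i)),
           \sum_(i < n) E i = 1%:M
         & X = \sum_(i < n) lambda i *: E i]].
Proof.
have [w [ww w1 TE]] := hermitian_eigenbasis _ _ _ _ hT hlambda.
apply/seteqP; split.
  apply: smallest_sub => [m X C XE C1|_ ->]; last first.
    exists (fun i => (w i) ^t* *m w i).
    by split=> // i; apply: psdmx_gram.
  have /choice [E EP] := XE.
  (* Found by substituting [X j = \sum_i lambda i *: E j i] and exchanging the two sums: this is the
     coefficient of [lambda i]. *)
  exists (fun i => \sum_j (C j) ^t* *m E j i *m C j); split.
  - by move=> i; apply: psdmx_sum => j; apply: psdmx_conj; case: (EP j).
  - rewrite exchange_big -C1; apply: eq_bigr => j _ /=.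
    by rewrite -mulmx_suml -mulmx_sumr; case: (EP j) => _ -> _; rewrite mulmx1.
  - under [RHS]eq_bigr do rewrite scaler_sumr.
    rewrite exchange_big; apply: eq_bigr => j _ /=.
    case: (EP j) => _ _ ->; rewrite mulmx_sumr mulmx_suml.
    by apply: eq_bigr => i _; rewrite -scalemxAr -scalemxAl.
move=> _ [E [E_psd E1 ->]] K [Kconv KT].
have /choice [f fE] i := psdmx_rank1_sum _ _ _ (E_psd i).
pose C (p : 'I_n * 'I_n) := (w p.1) ^t* *m f p.1 p.2.
have wTw i : w i *m T *m (w i) ^t* = (lambda i)%:M.
  by rewrite TE orthonormal_compress.
have -> : \sum_i lambda i *: E i = \sum_p (C p) ^t* *m T *m C p.
  rewrite -(pair_bigA _ (fun i k => (C (i, k)) ^t* *m T *m C (i, k))) /=.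
  apply: eq_bigr => i _; rewrite fE scaler_sumr; apply: eq_bigr => k _.
  (* Regrouping isolates the scalar [w i *m T *m (w i) ^t*] between the two copies of [f i k]. *)
  rewrite /C /= trmxC_mul trmxCK !mulmxA -2!(mulmxA (_ ^t*)) wTw.
  by rewrite mul_mx_scalar scalemxAl.
apply: (Cstar_convex_sum _ _ _ _ (fun=> T)) => // [_|]; first exact: KT.
(* With the identity written as [\sum_i E i], the inner sum over [k] has to give back [E i]; it does
   because each [w i] is a unit vector. *)
rewrite -(pair_bigA _ (fun i k => (C (i, k)) ^t* *m C (i, k))) -E1 /=.
apply: eq_bigr => i _; rewrite fE; apply: eq_bigr => k _.
by rewrite /C /= trmxC_mul trmxCK mulmxA -(mulmxA (_ ^t*)) ww eqxx mulmx1.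
Qed.
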